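(* Let $d \geq 2$ be an integer and let $A = \mathbb{Z}[di] = \{a + b\,di : a, b \in \mathbb{Z}\} \subset \mathbb{C}$, where $i^2=-1$. Then $E_2(A)$ is a subgroup of infinite index in $SL_2(A)$, and $E_2(A)$ is not a normal subgroup of $SL_2(A)$.
   Context: For a commutative ring $A$, $E_2(A)$ denotes the subgroup of $SL_2(A)$ generated by the elementary matrices, i.e. the matrices $\begin{pmatrix} 1 & x \\ 0 & 1\end{pmatrix}$ and $\begin{pmatrix} 1 & 0 \\ x & 1\end{pmatrix}$ with $x \in A$. *)

(* Defs.v *)
From HB Require Import structures.
From mathcomp Require Import all_boot all_order all_algebra.
From mathcomp Require Import boolp classical_sets cardinality reals.
From mathcomp.real_closed Require Import complex.
From mathcomp Require Import ring.
Set Implicit Arguments.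
Unset Strict Implicit.
Unset Printing Implicit Defensive.
Import GRing.Theory.
Local Open Scope classical_set_scope.
Local Open Scope ring_scope.

(* Subgroups of possibly infinite groups are classical sets satisfying
   [group_closed]. *)
Section Subgroups.
Variable G : groupType.
Implicit Types S H : set G.

Definition subgroup H : Prop := group_closed [in H].

Definition generated S : set G := smallest subgroup S.

Lemma generated_subgroup S : subgroup (generated S).
Proof.
split; first by rewrite inE => H /= [[/set_mem H1 _] _].
move=> x y; rewrite !inE => xS yS H /= HP.
have [[_ HV] _] := HP.
by apply/set_mem/HV; apply/mem_set; [exact: xS | exact: yS].
Qed.

Definition left_coset H (g : G) : set G := [set (g * h)%g | h in H].

Definition left_cosets H : set (set G) := range (left_coset H).

Definition infinite_index H : Prop := infinite_set (left_cosets H).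

Definition normal_subgroup H : Prop :=
  subgroup H /\ forall g h : G, H h -> H (g * h * g^-1)%g.

End Subgroups.

Section SL2.
Variable A : comNzRingType.

Record SL2 := MkSL2 { SL2_mx :> 'M[A]_2; SL2_det : \det SL2_mx == 1 }.

HB.instance Definition _ := [isSub for SL2_mx].
HB.instance Definition _ := [Choice of SL2 by <:].

Fact SL2_one_subproof : \det (1%:M : 'M[A]_2) == 1.
Proof. by rewrite det1. Qed.

Fact SL2_mul_subproof (g h : SL2) : \det (SL2_mx g *m SL2_mx h) == 1.
Proof. by rewrite det_mulmx (eqP (SL2_det g)) (eqP (SL2_det h)) mulr1. Qed.

Fact SL2_inv_subproof (g : SL2) : \det (\adj (SL2_mx g)) == 1.
Proof.
have := congr1 determinant (mul_mx_adj (SL2_mx g)).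
by rewrite det_mulmx det_scalar (eqP (SL2_det g)) mul1r expr1n => ->.
Qed.

Definition SL2_one := MkSL2 SL2_one_subproof.
Definition SL2_mul g h := MkSL2 (SL2_mul_subproof g h).
(* For determinant 1 the adjugate is the inverse, over any commutative ring. *)
Definition SL2_inv g := MkSL2 (SL2_inv_subproof g).

Fact SL2_mulA : associative SL2_mul.
Proof. by move=> f g h; apply/val_inj; rewrite /= mulmxA. Qed.

Fact SL2_mul1 : left_id SL2_one SL2_mul.
Proof. by move=> g; apply/val_inj; rewrite /= mul1mx. Qed.

Fact SL2_mulr1 : right_id SL2_one SL2_mul.
Proof. by move=> g; apply/val_inj; rewrite /= mulmx1. Qed.

Fact SL2_mulV : left_inverse SL2_one SL2_inv SL2_mul.
Proof.
by move=> g; apply/val_inj; rewrite /= mul_adj_mx (eqP (SL2_det g)).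
Qed.

Fact SL2_mulrV : right_inverse SL2_one SL2_inv SL2_mul.
Proof.
by move=> g; apply/val_inj; rewrite /= mul_mx_adj (eqP (SL2_det g)).
Qed.

HB.instance Definition _ :=
  isGroup.Build SL2 SL2_mulA SL2_mul1 SL2_mulr1 SL2_mulV SL2_mulrV.

(* [1%:M + x *: delta_mx i j] is the identity matrix with [x] added at the
   off-diagonal entry [(i, j)]. *)
Definition elementary2 : set SL2 :=
  [set g | exists x : A, SL2_mx g = 1%:M + x *: delta_mx 0 1
                      \/ SL2_mx g = 1%:M + x *: delta_mx 1 0].

Definition E2 : set SL2 := generated elementary2.

End SL2.

Arguments elementary2 A : clear implicits.
Arguments E2 A : clear implicits.

Section Zdi.
Variables (R : realType) (d : nat).
Local Open Scope complex_scope.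

Definition in_Zdi : {pred R[i]} :=
  fun z => `[< exists a b : int, z = a%:~R + b%:~R * (d%:R * 'i) >].

Fact in_Zdi_subring : subring_closed in_Zdi.
Proof.
have ii : 'i * 'i = -1 :> R[i] by rewrite -expr2 sqr_i.
split.
- by apply/asboolP; exists 1, 0; rewrite mul0r addr0.
- move=> _ _ /asboolP[a [b ->]] /asboolP[a' [b' ->]]; apply/asboolP.
  by exists (a - a'), (b - b'); rewrite !intrB mulrBl opprD addrACA.
move=> _ _ /asboolP[a [b ->]] /asboolP[a' [b' ->]]; apply/asboolP.
exists (a * a' - b * b' * (d * d)%N%:Z), (a * b' + b * a').
rewrite rmorphB rmorphD !rmorphM /= -!pmulrn.
have -> : (a%:~R + b%:~R * (d%:R * 'i)) * (a'%:~R + b'%:~R * (d%:R * 'i))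
  = a%:~R * a'%:~R + b%:~R * b'%:~R * (d%:R * d%:R) * ('i * 'i)
    + (a%:~R * b'%:~R + b%:~R * a'%:~R) * (d%:R * 'i) :> R[i] by ring.
by rewrite ii; ring.
Qed.

HB.instance Definition _ :=
  GRing.isSubringClosed.Build R[i] in_Zdi in_Zdi_subring.

Record Zdi := MkZdi { Zdi_val :> R[i]; Zdi_valP : Zdi_val \in in_Zdi }.

HB.instance Definition _ := [isSub for Zdi_val].
HB.instance Definition _ := [Choice of Zdi by <:].
HB.instance Definition _ := [SubChoice_isSubComNzRing of Zdi by <:].

End Zdi.

(* Main.v *)
(* E_2(A) is generated by SL_2(Z) and the translations by multiples of di. On the
   Riemann sphere an element of SL_2(Z) not fixing infinity maps {|Im| > 1} into
   {|Im| < 1}, while a nonzero translation by a multiple of di maps {|Im| < 1}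
   into {|Im| > 1}, as d >= 2. By ping-pong, two points of E_2(A) x whose
   SL_2(Z)-orbits stay in {|Im| < 1} differ by an element of SL_2(Z). For n = bd,
   the points (n + 1 + ni) / (n + 1 - ni) are of this kind, lie in the
   SL_2(A)-orbit of infinity, and are pairwise inequivalent under SL_2(Z); this
   gives infinitely many cosets. They are not real, so their unipotent
   stabilizers in SL_2(A), which are conjugate to the one of infinity, are not
   contained in SL_2(Z), hence not in E_2(A). *)
Require Import Defs.
From HB Require Import structures.
From mathcomp Require Import all_boot all_order all_algebra.
From mathcomp Require Import boolp classical_sets cardinality reals.
From mathcomp.real_closed Require Import complex.
From mathcomp Require Import ring lra zify.

Set Implicit Arguments.
Unset Strict Implicit.
Unset Printing Implicit Defensive.
Import Order.TTheory GRing.Theory Num.Theory.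
Local Open Scope ring_scope.

(** * Matrix entries and elementary matrices in SL_2 *)

Section SL2Entries.
Variable A : comNzRingType.
Implicit Types (g h : SL2 A) (x y : A).

Lemma ord2P (P : 'I_2 -> Prop) : P 0 -> P 1 -> forall i, P i.
Proof.
by move=> P0 P1 [[|[|//]] lt_i]; [move: P0 | move: P1];
  congr P; apply/val_inj.
Qed.

Lemma big_ord2 (F : 'I_2 -> A) : \sum_i F i = F 0 + F 1.
Proof.
rewrite big_ord_recl big_ord1; congr (_ + F _); exact/val_inj.
Qed.

Lemma det_mx2 (M : 'M[A]_2) : \det M = M 0 0 * M 1 1 - M 0 1 * M 1 0.
Proof.
rewrite (expand_det_row _ 0) big_ord2 /cofactor !det_mx11 !mxE /=.
have -> : lift 0 0 = 1 :> 'I_2 by apply/val_inj.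
have -> : lift 1 0 = 0 :> 'I_2 by apply/val_inj.
by rewrite expr0 expr1 mul1r mulN1r mulrN.
Qed.

Lemma SL2_ext g h :
  g 0 0 = h 0 0 -> g 0 1 = h 0 1 -> g 1 0 = h 1 0 -> g 1 1 = h 1 1 -> g = h.
Proof.
by move=> ????; apply/val_inj/matrixP; apply: ord2P; apply: ord2P.
Qed.

Lemma SL2_mulE g h i j : (g * h)%g i j = g i 0 * h 0 j + g i 1 * h 1 j.
Proof. by rewrite /= mxE big_ord2. Qed.

Lemma SL2_oneE i j : (1%g : SL2 A) i j = (i == j)%:R.
Proof. by rewrite /= mxE. Qed.

Lemma SL2_detE g : g 0 0 * g 1 1 - g 0 1 * g 1 0 = 1.
Proof. by rewrite -det_mx2; apply/eqP/SL2_det. Qed.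

Definition mx2 (a b c e : A) : 'M[A]_2 :=
  \matrix_(i, j) nth 0 (nth [::] [:: [:: a; b]; [:: c; e]] i) j.

Lemma mx2E a b c e :
  (mx2 a b c e 0 0 = a) * (mx2 a b c e 0 1 = b) *
  (mx2 a b c e 1 0 = c) * (mx2 a b c e 1 1 = e).
Proof. by rewrite !mxE. Qed.

Fact mx2_det a b c e : a * e - b * c = 1 -> \det (mx2 a b c e) == 1.
Proof. by rewrite det_mx2 !mxE /= => /eqP. Qed.

Definition sl2 a b c e (det1 : a * e - b * c = 1) : SL2 A :=
  MkSL2 (mx2_det det1).

Fact SL2_inv_det g : g 1 1 * g 0 0 - - g 0 1 * - g 1 0 = 1.
Proof. by rewrite mulrNN mulrC SL2_detE. Qed.

Lemma SL2_invE g : (g^-1)%g = sl2 (SL2_inv_det g).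
Proof.
apply: (mulgI g); rewrite mulgV.
apply: SL2_ext; rewrite SL2_mulE SL2_oneE /= !mx2E -?(SL2_detE g); ring.
Qed.

Fact upper_det x : 1 * 1 - x * 0 = 1 :> A. Proof. by ring. Qed.
Fact lower_det x : 1 * 1 - 0 * x = 1 :> A. Proof. by ring. Qed.
Fact flip_det : 0 * 0 - (- 1) * 1 = 1 :> A. Proof. by ring. Qed.

Definition upper x := sl2 (upper_det x).
Definition lower x := sl2 (lower_det x).
Definition flip := sl2 flip_det.

Lemma upperD x y : upper (x + y) = (upper x * upper y)%g.
Proof. by apply: SL2_ext; rewrite SL2_mulE /= !mx2E; ring. Qed.

Lemma upper0 : upper 0 = 1%g.
Proof. by apply: SL2_ext; rewrite SL2_oneE /= !mx2E. Qed.

(** As [flip] has integer entries, this leaves only SL_2(Z) and the upper elementary matrices to be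
    handled. *)
Lemma lower_flip x : lower x = (flip * upper (- x) * flip^-1)%g.
Proof.
by rewrite SL2_invE; apply: SL2_ext; rewrite !SL2_mulE /= !mx2E; ring.
Qed.

Lemma elementary2P g :
  elementary2 A g <-> exists x, g = upper x \/ g = lower x.
Proof.
have upE x : SL2_mx (upper x) = 1%:M + x *: delta_mx 0 1.
  by apply/matrixP; do 2![apply: ord2P]; rewrite !mxE /=; ring.
have loE x : SL2_mx (lower x) = 1%:M + x *: delta_mx 1 0.
  by apply/matrixP; do 2![apply: ord2P]; rewrite !mxE /=; ring.
split=> [] [x gE]; exists x.
  case: gE => gE; [left | right]; apply/val_inj => /=.
    by rewrite gE -upE.
  by rewrite gE -loE.
by case: gE => ->; [left; apply: upE | right; apply: loE].
Qed.

Lemma upper_E2 x : E2 A (upper x).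
Proof. by move=> H [_]; apply; apply/elementary2P; exists x; left. Qed.

End SL2Entries.

Section PingPong.
Variables (R : realType) (d : nat).
Local Notation A := (Zdi R d).
Local Notation G := (SL2 A).
Implicit Types (x y : A) (g h s : G) (a b k : int).

(** * Real and imaginary parts on Z[di] *)

Definition re x : R := complex.Re (Zdi_val x).
Definition im x : R := complex.Im (Zdi_val x).

Lemma reD x y : re (x + y) = re x + re y.
Proof. by case: x y => [[? ?] ?] [[? ?] ?]. Qed.

Lemma imD x y : im (x + y) = im x + im y.
Proof. by case: x y => [[? ?] ?] [[? ?] ?]. Qed.

Lemma reN x : re (- x) = - re x.
Proof. by case: x => [[? ?] ?]. Qed.

Lemma imN x : im (- x) = - im x.
Proof. by case: x => [[? ?] ?]. Qed.

Lemma reM x y : re (x * y) = re x * re y - im x * im y.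
Proof. by case: x y => [[? ?] ?] [[? ?] ?]. Qed.

Lemma imM x y : im (x * y) = re x * im y + im x * re y.
Proof. by case: x y => [[? ?] ?] [[? ?] ?]. Qed.

Lemma complex_intr k : k%:~R = (k%:~R : R)%:C%C :> R[i].
Proof. by rewrite rmorph_int. Qed.

Lemma Zdi_val_int k : Zdi_val (k%:~R : A) = (k%:~R : R)%:C%C.
Proof. by rewrite -complex_intr; apply: (rmorph_int (val : A -> R[i])). Qed.

Lemma re_int k : re k%:~R = k%:~R.
Proof. by rewrite /re Zdi_val_int. Qed.

Lemma im_int k : im k%:~R = 0.
Proof. by rewrite /im Zdi_val_int. Qed.

Fact omega_subproof : d%:R * 'i%C \in @in_Zdi R d.
Proof. by apply/asboolP; exists 0, 1; rewrite add0r mul1r. Qed.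

Definition omega : A := MkZdi omega_subproof.

Lemma ZdiP x : exists a b, x = a%:~R + b%:~R * omega.
Proof.
have /asboolP[a [b xE]] := Zdi_valP x; exists a, b; apply/val_inj => /=.
by rewrite xE !Zdi_val_int -!complex_intr.
Qed.

Lemma re_omega : re omega = 0.
Proof. by rewrite /re /= -[d%:R]/(d%:Z%:~R) complex_intr /=; ring. Qed.

Lemma im_omega : im omega = d%:R.
Proof. by rewrite /im /= -[d%:R]/(d%:Z%:~R) complex_intr /=; ring. Qed.

Lemma re_Zdi a b : re (a%:~R + b%:~R * omega) = a%:~R.
Proof. by rewrite reD reM !re_int im_int re_omega; ring. Qed.

Lemma im_Zdi a b : im (a%:~R + b%:~R * omega) = b%:~R * d%:R.
Proof. by rewrite imD imM re_int !im_int im_omega; ring. Qed.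

Lemma Zdi_ext x y : re x = re y -> im x = im y -> x = y.
Proof.
move=> rexy imxy; apply/val_inj/eqP; rewrite eq_complex.
by apply/andP; split; apply/eqP.
Qed.

Lemma Zdi_int_inj : injective (intr : int -> A).
Proof.
by move=> a b /(congr1 re); rewrite !re_int => /intr_inj.
Qed.

(** * SL_2(Z) inside SL_2(A) *)

Definition integral g := forall i j, exists k, g i j = k%:~R.

Lemma integralP g : integral g <->
  [/\ exists k, g 0 0 = k%:~R, exists k, g 0 1 = k%:~R,
      exists k, g 1 0 = k%:~R & exists k, g 1 1 = k%:~R].
Proof. by split=> [gZ | [????]]; [split; apply: gZ | do 2![apply: ord2P]]. Qed.

Lemma integralM g h : integral g -> integral h -> integral (g * h)%g.
Proof.
move=> gZ hZ i j; rewrite SL2_mulE.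
have [[a ->] [b ->]] := (gZ i 0, gZ i 1).
have [[a' ->] [b' ->]] := (hZ 0 j, hZ 1 j).
by exists (a * a' + b * b'); rewrite rmorphD !rmorphM.
Qed.

Lemma integralV g : integral g -> integral g^-1%g.
Proof.
move=> gZ; rewrite SL2_invE; apply/integralP; rewrite /= !mx2E.
have [[[a ->] [b ->]] [[c ->] [e ->]]] := ((gZ 0 0, gZ 0 1), (gZ 1 0, gZ 1 1)).
by split; [exists e | exists (- b) | exists (- c) | exists a]; rewrite ?rmorphN.
Qed.

Lemma integral1 : integral 1%g.
Proof. by move=> i j; exists (i == j); rewrite SL2_oneE; case: (i == j). Qed.

Lemma integral_flip : integral (flip A).
Proof.
apply/integralP; rewrite /= !mx2E.
by split; [exists 0 | exists (-1) | exists 1 | exists 0]; rewrite ?rmorphN.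
Qed.

Lemma integral_upper k : integral (upper (k%:~R : A)).
Proof.
apply/integralP; rewrite /= !mx2E.
by split; [exists 1 | exists k | exists 0 | exists 1].
Qed.

(* With z = g 0 0 / g 1 0 the image of the cusp at infinity, area g / dnorm g is
   the imaginary part of z. *)
Definition area g := im (g 0 0) * re (g 1 0) - re (g 0 0) * im (g 1 0).
Definition dnorm g := re (g 1 0) ^+ 2 + im (g 1 0) ^+ 2.

Lemma integral_entries s : integral s -> exists a b c e,
  [/\ s 0 0 = a%:~R, s 0 1 = b%:~R, s 1 0 = c%:~R, s 1 1 = e%:~R
    & a * e - b * c = 1].
Proof.
move=> sZ; have := SL2_detE s.
have [[[a sa] [b sb]] [[c sc] [e se]]] := ((sZ 0 0, sZ 0 1), (sZ 1 0, sZ 1 1)).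
rewrite sa sb sc se -!rmorphM -rmorphB => /(@Zdi_int_inj _ 1) sdet.
by exists a, b, c, e.
Qed.

(** * The two ping-pong moves on the height of a cusp *)

Lemma re_lin a b x y : re (a%:~R * x + b%:~R * y) = a%:~R * re x + b%:~R * re y.
Proof. by rewrite reD !reM !re_int !im_int; ring. Qed.

Lemma im_lin a b x y : im (a%:~R * x + b%:~R * y) = a%:~R * im x + b%:~R * im y.
Proof. by rewrite imD !imM !re_int !im_int; ring. Qed.

(** Up to sign, [area g] is the determinant of the real matrix whose rows are the (re, im) of the
    first-column entries; [s] acts on these rows with determinant 1. *)
Lemma area_integral s g : integral s -> area (s * g)%g = area g.
Proof.
move=> /integral_entries[a [b [c [e [sa sb sc se sdet]]]]].
rewrite /area !SL2_mulE sa sb sc se !re_lin !im_lin.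
have: (a * e - b * c)%:~R = 1 :> R by rewrite sdet.
rewrite rmorphB !rmorphM /= => detR.
by rewrite -[RHS]mul1r -[X in _ = X * _]detR; ring.
Qed.

(** For (p, q) the first column of [g], both sides are |(c p + e q) conj(q)|^2; the imaginary part
    of p conj(q) is [area g]. *)
Lemma dnorm_integral_mul s g c e :
  s 1 0 = c%:~R -> s 1 1 = e%:~R ->
  dnorm g * dnorm (s * g)%g = c%:~R ^+ 2 * area g ^+ 2
    + (c%:~R * (re (g 0 0) * re (g 1 0) + im (g 0 0) * im (g 1 0))
       + e%:~R * dnorm g) ^+ 2.
Proof.
move=> sc se; rewrite /dnorm /area !SL2_mulE sc se !re_lin !im_lin; ring.
Qed.

Lemma dnorm_ge0 g : 0 <= dnorm g.
Proof. by rewrite addr_ge0 ?sqr_ge0. Qed.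

(** Im(sz) = Im z / |cz + e|^2 and |cz + e| >= |c Im z| >= |Im z|, so |Im(sz)| <= 1 / |Im z| < 1. *)
Lemma integral_swap s g : integral s -> s 1 0 != 0 -> dnorm g < `|area g| ->
  `|area (s * g)%g| < dnorm (s * g)%g.
Proof.
move=> sZ; rewrite area_integral //.
have [a [b [c [e [sa sb sc se sdet]]]]] := integral_entries sZ.
rewrite sc => c0 ltND; have N0 := dnorm_ge0 g.
have c1 : 1 <= (c%:~R : R) ^+ 2.
  have: c != 0 by apply: contraNneq c0 => ->.
  by rewrite -rmorphXn /= ler1z; nia.
have NN := dnorm_integral_mul g sc se.
have D0 : 0 < `|area g| by apply: le_lt_trans ltND.
(* With D the area and N, N' the two norms, N' <= |D| would give N N' <= N |D| < D^2 <= c^2 D^2 <= N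
   N'. *)
rewrite ltNge; apply/negP => N'D.
have := ler_wpM2l N0 N'D; rewrite NN leNgt => /negP; apply.
apply: (@lt_le_trans _ _ (`|area g| * `|area g|)); first by rewrite ltr_pM2r.
rewrite -expr2 real_normK ?num_real // ler_wpDr ?sqr_ge0 //.
by rewrite ler_peMl ?sqr_ge0.
Qed.

Definition tau b := upper (b%:~R * omega).

Lemma area_tau b g : area (tau b * g)%g = area g + b%:~R * d%:R * dnorm g.
Proof.
rewrite /area /dnorm !SL2_mulE /= !mx2E !mul0r !add0r !mul1r.
rewrite !(reD, imD, reM, imM).
by rewrite re_omega im_omega re_int im_int; ring.
Qed.

Lemma dnorm_tau b g : dnorm (tau b * g)%g = dnorm g.
Proof. by rewrite /dnorm !SL2_mulE /= !mx2E mul0r add0r mul1r. Qed.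

(** The height moves by b d, and |b d| >= 2, so a height below 1 in absolute value ends above 1. *)
Lemma tau_swap b g : (2 <= d)%N -> b != 0 -> `|area g| < dnorm g ->
  dnorm (tau b * g)%g < `|area (tau b * g)%g|.
Proof.
move=> d2 b0; rewrite area_tau dnorm_tau => ltDN.
have bd2 : 2 <= `|b%:~R * d%:R : R|.
  rewrite normrM -intr_norm normr_nat -[d%:R]/(d%:Z%:~R) -intrM (ler_int _ 2).
  by nia.
have := ler_normB (b%:~R * d%:R * dnorm g + area g) (area g).
rewrite addrK normrM (ger0_norm (dnorm_ge0 g)) [_ + area g]addrC.
have := dnorm_ge0 g; nra.
Qed.

(** * Alternating words in SL_2(Z) and translations *)

(** The inner factors must move infinity, for [integral_swap] to apply to them; the rightmost one is
    free, since it will act on a deep cusp. *)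
Inductive tau_led : G -> Prop :=
| tau_led_base b s : b != 0 -> integral s -> tau_led (tau b * s)%g
| tau_led_step b s g : b != 0 -> integral s -> s 1 0 != 0 -> tau_led g ->
    tau_led (tau b * (s * g))%g.

Definition alternating g :=
  integral g \/ exists s h, [/\ integral s, tau_led h & g = (s * h)%g].

Lemma tauD a b : tau (a + b) = (tau a * tau b)%g.
Proof. by rewrite /tau rmorphD mulrDl upperD. Qed.

Lemma tau0 : tau 0 = 1%g.
Proof. by rewrite /tau mul0r upper0. Qed.

(** Such an [s] is plus or minus an integer translation, because a e = 1 in Z forces a = e. *)
Lemma tau_comm b s : integral s -> s 1 0 = 0 -> (tau b * s = s * tau b)%g.
Proof.
move=> /integral_entries[a [k [c [e [sa sb sc se sdet]]]]] sc0.
have c0 : c = 0 by apply: Zdi_int_inj; rewrite -sc.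
have ae : a = e.
  rewrite c0 mulr0 subr0 in sdet.
  have /orP[] : (e == 1) || (e == -1) := intUnitRing.unitzPl sdet.
    by move/eqP=> eE; move: sdet; rewrite eE mulr1.
  by move/eqP=> eE; move: sdet; rewrite eE mulrN1 => <-; rewrite opprK.
apply: SL2_ext; rewrite !SL2_mulE ?sa ?sb ?sc ?se /= !mx2E ?c0 ?ae; ring.
Qed.

Lemma alternatingM s g : integral s -> alternating g -> alternating (s * g)%g.
Proof.
move=> sZ [gZ | [t [h [tZ h_led ->]]]]; first by left; apply: integralM.
by right; exists (s * t)%g, h; rewrite mulgA; split=> //; apply: integralM.
Qed.

Lemma alternating_tau_led b h : tau_led h -> alternating (tau b * h)%g.
Proof.
case=> [c s c0 sZ | c s g c0 sZ s10 g_led]; rewrite mulgA -tauD.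
  have [-> | bc0] := eqVneq (b + c) 0; first by rewrite tau0 mul1g; left.
  right; exists 1%g, (tau (b + c) * s)%g; rewrite mul1g.
  by split; [apply: integral1 | apply: tau_led_base |].
have [-> | bc0] := eqVneq (b + c) 0.
  by rewrite tau0 mul1g; right; exists s, g.
right; exists 1%g, (tau (b + c) * (s * g))%g; rewrite mul1g.
by split; [apply: integral1 | apply: tau_led_step |].
Qed.

Lemma alternating_tau b g : alternating g -> alternating (tau b * g)%g.
Proof.
have [-> | b0] := eqVneq b 0; first by rewrite tau0 mul1g.
case=> [gZ | [s [h [sZ h_led ->]]]].
  right; exists 1%g, (tau b * g)%g; rewrite mul1g.
  by split; [apply: integral1 | apply: tau_led_base |].
(* If [s] fixes infinity, the translation passes through it and merges with the leading one of
   [h]. *)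
have [s10 | s10] := eqVneq (s 1 0) 0.
  rewrite mulgA tau_comm // -mulgA.
  exact/alternatingM/alternating_tau_led.
right; exists 1%g, (tau b * (s * h))%g; rewrite mul1g.
by split; [apply: integral1 | apply: tau_led_step |].
Qed.

Lemma alternating_upper x g : alternating g -> alternating (upper x * g)%g.
Proof.
have [a [b ->]] := ZdiP x; rewrite upperD -mulgA => g_alt.
exact/(alternatingM (integral_upper a))/alternating_tau.
Qed.

Lemma alternating_elementary e g :
  elementary2 A e -> alternating g -> alternating (e * g)%g.
Proof.
case/elementary2P=> x [] -> g_alt; first exact: alternating_upper.
rewrite lower_flip -!mulgA.
apply: (alternatingM integral_flip); apply: alternating_upper.
exact: (alternatingM (integralV integral_flip)).
Qed.

Lemma elementary2V e : elementary2 A e -> elementary2 A e^-1%g.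
Proof.
case/elementary2P=> x [] ->; apply/elementary2P; exists (- x); [left | right];
  by rewrite SL2_invE; apply: SL2_ext; rewrite /= !mx2E ?oppr0.
Qed.

Lemma E2_alternating e : E2 A e -> alternating e.
Proof.
(* Asking for an equivalence builds stability under inverses into [K], so that minimality of the
   generated subgroup applies. *)
pose K :=
  [set h : G | forall g, alternating (h * g)%g <-> alternating g]%classic.
have subK : subgroup K.
  split=> [|h k]; rewrite !inE; first by move=> g; rewrite mul1g.
  by move=> hK kK g; rewrite -mulgA hK -kK mulVKg.
have eltK : (elementary2 A `<=` K)%classic.
  move=> h h_elt g; split; last exact: alternating_elementary.
  by move=> /(alternating_elementary (elementary2V h_elt)); rewrite mulKg.
move=> /(_ K (conj subK eltK) 1%g); rewrite mulg1 => -[_]; apply.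
by left; apply: integral1.
Qed.

(* The cusps that no element of SL_2(Z) moves to height |Im| at least 1. *)
Definition deep g :=
  forall s, integral s -> `|area (s * g)%g| < dnorm (s * g)%g.

Hypothesis d2 : (2 <= d)%N.

(** * Ping-pong on deep cusps *)

Lemma tau_led_area h g : tau_led h -> deep g ->
  dnorm (h * g)%g < `|area (h * g)%g|.
Proof.
move=> h_led g_deep; elim: h_led => [b s b0 sZ | b s k b0 sZ s10 _ IH].
  by rewrite -mulgA; apply/(tau_swap d2 b0)/g_deep.
by rewrite -!mulgA; apply/(tau_swap d2 b0)/integral_swap.
Qed.

(** If e = s h with [h] led by a translation, then s^-1 moves the cusp of e g to that of h g, of
    height above 1, so e g is not deep. *)
Lemma E2_deep e g : E2 A e -> deep g -> deep (e * g)%g -> integral e.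
Proof.
move=> /E2_alternating[// | [s [h [sZ h_led ->]]]] g_deep.
rewrite -mulgA => /(_ _ (integralV sZ)); rewrite mulKg => lt_area.
by have := lt_trans lt_area (tau_led_area h_led g_deep); rewrite ltxx.
Qed.

Lemma mul_upper_col g x i : (g * upper x)%g i 0 = g i 0.
Proof. by rewrite SL2_mulE /= !mx2E mulr1 mulr0 addr0. Qed.

(** Depth depends only on the image of infinity, which [upper x] fixes. *)
Lemma deep_upper g x : deep g -> deep (g * upper x)%g.
Proof.
move=> g_deep s sZ; have := g_deep s sZ; rewrite mulgA /area /dnorm.
by rewrite !mul_upper_col.
Qed.

(* With n = b d and z = n + 1 + n i, the matrix has rows (z, n) and
   (conj z, 1 - n i), and determinant |z|^2 - n (z + conj z) = 1. *)
Fact cusp_det b :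
  ((b * d%:Z + 1)%:~R + b%:~R * omega) * (1%:~R + (- b)%:~R * omega)
  - ((b * d%:Z)%:~R + 0%:~R * omega)
    * ((b * d%:Z + 1)%:~R + (- b)%:~R * omega) = 1.
Proof.
rewrite -mulN1r -(intrN _ 1); apply: Zdi_ext.
  rewrite reD !(reM, re_Zdi, im_Zdi) re_int im_int (re_int 1).
  by rewrite !(rmorphD, rmorphM, rmorphN) /=; ring.
rewrite imD !(imM, reM, re_Zdi, im_Zdi) re_int im_int (im_int 1).
by rewrite !(rmorphD, rmorphM, rmorphN) /=; ring.
Qed.

Definition cusp b := sl2 (cusp_det b).

(** For z = n + 1 + n i, the left side is the area of the cusp and the right side is |c z + e
    conj(z)|^2. The case c + e = 0 requires n > 1; when c + e and c - e are both nonzero, the margin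
    is at least (n + 1)^2 + n^2 - 2 n (n + 1) = 1. *)
Lemma cusp_form_gt (n c e : int) : 2 <= n -> (c != 0) || (e != 0) ->
  2 * n * (n + 1) < ((c + e) * (n + 1)) ^+ 2 + ((c - e) * n) ^+ 2.
Proof.
move=> n2 ce0; rewrite !exprMn.
have [u0 | u0] := eqVneq (c + e) 0.
  have c1 : 1 <= c ^+ 2 by nia.
  have -> : e = - c by lia.
  nia.
have [v0 | v0] := eqVneq (c - e) 0.
  have c1 : 1 <= c ^+ 2 by nia.
  have -> : e = c by lia.
  nia.
have u1 : 1 <= (c + e) ^+ 2 by nia.
have v1 : 1 <= (c - e) ^+ 2 by nia.
nia.
Qed.

Lemma area_cusp b : area (cusp b) = (2 * (b * d%:Z) * (b * d%:Z + 1))%:~R.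
Proof.
rewrite /area /= !mx2E !re_Zdi !im_Zdi !(rmorphD, rmorphM, rmorphN) /=; ring.
Qed.

Lemma cusp_deep b : 0 < b -> deep (cusp b).
Proof.
move=> b0 s sZ; rewrite area_integral // area_cusp.
have [a [k [c [e [sa sb sc se sdet]]]]] := integral_entries sZ.
have n2 : 2 <= b * d%:Z by nia.
rewrite ger0_norm; last by rewrite ler0z; nia.
rewrite /dnorm !SL2_mulE sc se re_lin im_lin /= !mx2E !re_Zdi !im_Zdi.
have -> : (c%:~R * (b * d%:Z + 1)%:~R + e%:~R * (b * d%:Z + 1)%:~R) ^+ 2 +
    (c%:~R * (b%:~R * d%:R) + e%:~R * ((- b)%:~R * d%:R)) ^+ 2 =
    (((c + e) * (b * d%:Z + 1)) ^+ 2 + ((c - e) * (b * d%:Z)) ^+ 2)%:~R :> R.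
  by rewrite !(rmorphD, rmorphM, rmorphN, rmorphXn) /=; ring.
rewrite ltr_int; apply: cusp_form_gt => //.
have [c0 | //] := eqVneq c 0; have [e0 | //] := eqVneq e 0.
by move: sdet; rewrite c0 e0 !mulr0.
Qed.

(** * Infinite index and failure of normality *)

Lemma cusp_coset_inj b b' : 0 < b -> 0 < b' ->
  left_coset (E2 A) (cusp b)^-1%g = left_coset (E2 A) (cusp b')^-1%g -> b = b'.
Proof.
move=> b0 b0' coset_eq.
have: left_coset (E2 A) (cusp b)^-1%g (cusp b)^-1%g.
  exists 1%g; last by rewrite mulg1.
  by have [/set_mem] := generated_subgroup (elementary2 A).
(* The coset equality yields h in E_2 with h [cusp b] = [cusp b']; then [h] is integral and
   preserves the area 2 n (n + 1), which determines n > 0. *)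
rewrite coset_eq => -[h hE2 /(congr1 (fun g => cusp b' * g * cusp b)%g)].
rewrite mulgA mulgV mul1g -mulgA mulVg mulg1 => hb.
have hZ : integral h.
  by apply: (E2_deep hE2 (cusp_deep b0)); rewrite hb; apply: cusp_deep.
have := area_integral (cusp b) hZ; rewrite hb !area_cusp => /intr_inj.
have d0 : d%:Z != 0 by lia.
have [n0 n0'] : 0 < b * d%:Z /\ 0 < b' * d%:Z by split; nia.
move=> nn; apply: (mulIf d0); move: n0 n0' nn.
move: (b * _) (b' * _) => n n'; nia.
Qed.

Lemma E2_infinite_index : infinite_index (E2 A).
Proof.
rewrite /infinite_index /left_cosets.
(* The shift to [k.+1] makes the parameter positive, as depth of the cusp requires. *)
pose coset (k : nat) := left_coset (E2 A) (cusp k.+1)^-1%g.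
apply: (@sub_infinite_set _ (range coset)).
  by move=> _ [k _ <-]; exists (cusp k.+1)^-1%g.
move=> /(finite_preimage (f := coset)).
rewrite preimage_range => fin_nat; apply: infinite_nat; apply: fin_nat.
by move=> k k' _ _ /cusp_coset_inj-/(_ isT isT) [].
Qed.

Lemma E2_not_normal : ~ normal_subgroup (E2 A).
Proof.
move=> [_ /(_ (cusp 1) _ (upper_E2 1))].
set h := (_ * _)%g => hE2.
have /integral_entries[a [b [c [e [_ _ hc _ _]]]]] : integral h.
  apply: (E2_deep hE2 (@cusp_deep 1 _)) => //.
  (* Here h [cusp 1] = [cusp 1] [upper 1], which has the same deep cusp. *)
  by rewrite /h -mulgA mulVg mulg1; apply/deep_upper/cusp_deep.
(* The lower-left entry of [h] is -(d + 1 - d i)^2, with imaginary part 2 d (d + 1), whereas an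
   integral matrix has real entries. *)
have := congr1 im hc; rewrite im_int /h SL2_invE !SL2_mulE /= !mx2E.
rewrite !(mulr0, mulr1, addr0) !(imD, imM, reD, reM, reN, imN, re_Zdi, im_Zdi).
rewrite mul1r rmorphD /= => im0.
have d_gt0 : 0 < d%:R :> R by rewrite ltr0n; lia.
have: 2 * d%:R * (d%:R + 1) = 0 :> R by rewrite -[RHS]im0; ring.
by move/eqP; rewrite gt_eqF // !mulr_gt0 // addr_gt0.
Qed.
End PingPong.

Theorem mainTheorem1 (R : realType) (d : nat) (hd : (2 <= d)%N) :
  [/\ subgroup (E2 (Zdi R d)),
      infinite_index (E2 (Zdi R d)) &
      ~ normal_subgroup (E2 (Zdi R d))].
Proof.
by split; [apply: generated_subgroup | apply: E2_infinite_index
  | apply: E2_not_normal].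
Qed.
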